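(* Let $0<q<1$. (a) The function $x\mapsto\Gamma_q\left(\frac{1-x}{x}\right)$ is strictly log-convex on $(0,\frac12]$. (b) The function $x\mapsto\frac{\Gamma_q(1-x)}{\Gamma_q(x)}$ is strictly log-concave on $(0,\frac12]$.
   Context: For $0<q<1$ and complex $a$, $(a;q)_\infty=\prod_{i=0}^{\infty}(1-aq^i)$. For real $x>0$, the $q$-gamma function is $\Gamma_q(x)=\frac{(q;q)_\infty}{(q^x;q)_\infty}(1-q)^{1-x}$. A positive function is strictly log-convex (resp. strictly log-concave) if its logarithm is strictly convex (resp. strictly concave). *)

(* Defs.v *)
From mathcomp Require Import all_boot all_order all_algebra.
From mathcomp Require Import all_classical all_reals all_analysis.

Set Implicit Arguments.
Unset Strict Implicit.
Unset Printing Implicit Defensive.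

Import Order.TTheory GRing.Theory Num.Theory.
Import numFieldNormedType.Exports.

Local Open Scope classical_set_scope.
Local Open Scope ring_scope.

(* (a; q)_oo, over any numeric field K so that a may be real or complex.
   As a [limn] this is meaningful only when the partial products converge,
   in particular for real 0 < q < 1 when K is the reals or the complexes. *)
Definition qpochhammer (K : numFieldType) (a q : K) : K :=
  limn (fun n : nat => \prod_(0 <= i < n) (1 - a * q ^+ i)).

(* Meant for 0 < q < 1 and 0 < x; elsewhere the value is not meaningful. *)
Definition qgamma (R : realType) (q x : R) : R :=
  qpochhammer q q / qpochhammer (q `^ x) q * (1 - q) `^ (1 - x).

Definition strictly_convex_on (R : realType) (D : set R) (f : R -> R) : Prop :=
  forall x y t : R, D x -> D y -> x != y -> 0 < t -> t < 1 ->
    f (t * x + (1 - t) * y) < t * f x + (1 - t) * f y.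

Definition strictly_concave_on (R : realType) (D : set R) (f : R -> R) : Prop :=
  forall x y t : R, D x -> D y -> x != y -> 0 < t -> t < 1 ->
    t * f x + (1 - t) * f y < f (t * x + (1 - t) * y).

(* Positivity is part of the definitions because [ln] is 0 on nonpositive
   reals. *)
Definition strictly_log_convex_on (R : realType) (D : set R) (f : R -> R) :
    Prop :=
  (forall x, D x -> 0 < f x) /\ strictly_convex_on D (fun x => ln (f x)).

Definition strictly_log_concave_on (R : realType) (D : set R) (f : R -> R) :
    Prop :=
  (forall x, D x -> 0 < f x) /\ strictly_concave_on D (fun x => ln (f x)).

(* Main.v *)
Require Import Defs.
From mathcomp Require Import all_boot all_order all_algebra.
From mathcomp Require Import all_classical all_reals all_analysis.
From mathcomp Require Import ring lra.

Import Order.TTheory GRing.Theory Num.Theory.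
Import numFieldNormedType.Exports.

Set Implicit Arguments.
Unset Strict Implicit.
Unset Printing Implicit Defensive.

Local Open Scope classical_set_scope.
Local Open Scope ring_scope.

(** Truncating both infinite products after n factors gives smooth functions
    g_n (ln_qgamma_partial) converging pointwise to ln Gamma_q on the positive
    reals. Convexity is read off the second derivatives of g_n, so no series
    is ever differentiated term by term. Pointwise limits preserve
    convexity but not its strictness; chord_gap_lim_gt0 restores strictness
    by comparing all the g_n with one fixed strictly convex function w, up to
    an error in the second derivative that tends to 0.

    Write L = - ln q, u = q ^ y, u_i = u q ^ i. Then
      g_n' (y) = - L * sum_i u_i / (1 - u_i) - ln (1 - q),
      g_n''(y) = L ^ 2 * sum_i u_i / (1 - u_i) ^ 2.

    Concavity of the quotient Gamma_q (1 - x) / Gamma_q x: each summand of g_n''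
    decreases in y, because u / (1 - u) ^ 2 (the Koebe function) increases
    in u. Hence every summand of g_n'' x - g_n'' (1 - x) is positive for
    x < 1/2, and the summand i = 0 alone serves as w.

    Convexity of Gamma_q ((1 - x) / x): with y = (1 - x) / x >= 1 one has
      (g o y)'' = x ^ -3 * ((y + 1) * g'' y + 2 * g' y),
    so the point is that (y + 1) psi' + 2 psi > 0 on y >= 1 for the
    logarithmic derivative psi of Gamma_q. Put A = L u / (1 - u) and
    [y] = (1 - u) / (1 - q). Telescoping over y, y + 1, y + 2, etc. gives
      psi' y > A   and   psi y >= ln [y] - A,
    whence (y + 1) psi' + 2 psi > (y - 1) A + 2 ln [y] >= 0. Both telescoping
    bounds come from ln t <= t - 1 alone (koebe_ge_odds_diff and
    odds_le_ln_diff); the first retains the explicit surplus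
    (L (1 - q) u) ^ 2 / L, which on a compact interval of x bounds the second
    derivative below by a constant c, so that w = c x ^ 2 / 2. *)

(** * Strict convexity of pointwise limits *)

(** Convexity is handled through this gap because it is linear and pointwise
    continuous in f: gaps can be added, subtracted and passed to the limit. *)
Definition chord_gap (R : realType) (f : R -> R) (a b t : R) : R :=
  t * f a + (1 - t) * f b - f (t * a + (1 - t) * b).

Lemma is_derive_within_continuous (R : realType) (f f1 : R -> R) (a b : R) :
  (forall x, a <= x <= b -> is_derive x 1 f (f1 x)) ->
  {within `[a, b], continuous f}.
Proof.
move=> df; apply: derivable_within_continuous => x /[!in_itv]/= /df dfx.
exact: ex_derive.
Qed.

(** Two applications of the mean value theorem on either side of the inner point
    express the chord slopes as f1 c and f1 d with c < d; a third one, for f1,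
    orders them. Positivity of f2 is asked on the
    open interval so that f2 may vanish at an endpoint, as happens at 1/2 for
    the symmetric quotient of q-gamma values. *)
Lemma chord_gap_gt0 (R : realType) (f f1 f2 : R -> R) (a b t : R) :
  a < b -> 0 < t -> t < 1 ->
  (forall x, a <= x <= b -> is_derive x 1 f (f1 x)) ->
  (forall x, a <= x <= b -> is_derive x 1 f1 (f2 x)) ->
  (forall x, a < x < b -> 0 < f2 x) ->
  0 < chord_gap f a b t.
Proof.
move=> ab t0 t1 df df1 f2_gt0; rewrite /chord_gap.
set z := t * a + (1 - t) * b.
have az : a < z by rewrite /z; nra.
have zb : z < b by rewrite /z; nra.
have [||c] := @MVT R f f1 a z az.
- by move=> x /[!in_itv]/= /andP[? ?]; apply: df; lra.
- apply: (@is_derive_within_continuous _ _ f1) => x /andP[? ?].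
  by apply: df; lra.
rewrite in_itv/= => /andP[ac cz] fc.
have [||d] := @MVT R f f1 z b zb.
- by move=> x /[!in_itv]/= /andP[? ?]; apply: df; lra.
- apply: (@is_derive_within_continuous _ _ f1) => x /andP[? ?].
  by apply: df; lra.
rewrite in_itv/= => /andP[zd db] fd.
have cd : c < d by lra.
have [||e] := @MVT R f1 f2 c d cd.
- by move=> x /[!in_itv]/= /andP[? ?]; apply: df1; lra.
- apply: (@is_derive_within_continuous _ _ f2) => x /andP[? ?].
  by apply: df1; lra.
rewrite in_itv/= => /andP[ce ed] f1e.
have f2e : 0 < f2 e by apply: f2_gt0; lra.
have f1cd : f1 c < f1 d by rewrite -subr_gt0 f1e mulr_gt0// subr_gt0.
have -> : t * f a + (1 - t) * f b - f z
    = (1 - t) * (f b - f z) - t * (f z - f a) by ring.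
rewrite fc fd.
have -> : b - z = t * (b - a) by rewrite /z; ring.
have -> : z - a = (1 - t) * (b - a) by rewrite /z; ring.
have -> : (1 - t) * (f1 d * (t * (b - a))) - t * (f1 c * ((1 - t) * (b - a)))
    = t * (1 - t) * (b - a) * (f1 d - f1 c) by ring.
by rewrite !mulr_gt0// subr_gt0.
Qed.

(** F n + eps n * x ^ 2 / 2 - w has positive second derivative, hence positive
    gap; letting n go to infinity, the gap of f is at least that of w, which
    is positive. *)
Lemma chord_gap_lim_gt0 (R : realType) (f w w1 w2 : R -> R)
    (F F1 F2 : nat -> R -> R) (eps : nat -> R) (a b t : R) :
  a < b -> 0 < t -> t < 1 ->
  (forall x, a <= x <= b -> F n x @[n --> \oo] --> f x) ->
  eps n @[n --> \oo] --> 0 ->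
  (forall n x, a <= x <= b -> is_derive x 1 (F n) (F1 n x)) ->
  (forall n x, a <= x <= b -> is_derive x 1 (F1 n) (F2 n x)) ->
  (forall x, a <= x <= b -> is_derive x 1 w (w1 x)) ->
  (forall x, a <= x <= b -> is_derive x 1 w1 (w2 x)) ->
  (forall x, a < x < b -> 0 < w2 x) ->
  (forall n x, a < x < b -> w2 x - eps n < F2 n x) ->
  0 < chord_gap f a b t.
Proof.
move=> ab t0 t1 Ff eps0 dF dF1 dw dw1 w2_gt0 F2_gt.
apply: lt_le_trans (chord_gap_gt0 ab t0 t1 dw dw1 w2_gt0) _.
pose s (x : R) : R := 2^-1 * x ^+ 2.
have ds (x : R) : is_derive x 1 s x.
  rewrite /s; apply: is_derive_eq.
  by rewrite /GRing.scale/= mulr1; field.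
have gapF n :
    chord_gap w a b t <= chord_gap (F n) a b t + eps n * chord_gap s a b t.
  pose G := fun x => F n x + eps n * s x - w x.
  have : 0 < chord_gap G a b t.
    apply: (@chord_gap_gt0 _ G (fun x => F1 n x + eps n * x - w1 x)
      (fun x => F2 n x + eps n - w2 x)) => // x xab.
    - have := dF n _ xab; have := dw _ xab => ? ?.
      by apply: is_derive_eq; rewrite /= -[_ *: _]/(_ * _).
    - have := dF1 n _ xab; have := dw1 _ xab => ? ?.
      by apply: is_derive_eq; rewrite /= -[_ *: _]/(_ * _) mulr1.
    - by have := F2_gt n _ xab; lra.
  by rewrite /chord_gap /G; lra.
have cvF : chord_gap (F n) a b t + eps n * chord_gap s a b t @[n --> \oo]
    --> chord_gap f a b t + 0 * chord_gap s a b t.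
  apply: cvgD; last by apply: cvgM => //; exact: cvg_cst.
  rewrite /chord_gap; apply: cvgB; last by apply: Ff; nra.
  by apply: cvgD; apply: cvgM; first [exact: cvg_cst | apply: Ff; lra].
rewrite mul0r addr0 in cvF.
by apply: (ler_cvg_to (cvg_cst _) cvF); near=> n; exact: gapF.
Unshelve. all: by end_near. Qed.

Lemma strictly_convex_on_chord_gap (R : realType) (D : set R) (f : R -> R) :
  (forall a b t, D a -> D b -> a < b -> 0 < t -> t < 1 ->
    0 < chord_gap f a b t) -> strictly_convex_on D f.
Proof.
move=> gap x y t Dx Dy xy t0 t1; rewrite -subr_gt0.
have [lt_xy|lt_yx|/eqP] := ltgtP x y; last by rewrite (negbTE xy).
  exact: gap.
have := gap y x (1 - t) Dy Dx lt_yx.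
rewrite /chord_gap opprB addrCA subrr addr0.
rewrite [(1 - t) * f y + _]addrC [(1 - t) * y + _]addrC.
by apply; lra.
Qed.

(** * Logarithm of the q-gamma function as a limit of finite sums *)

Lemma ln_le_subr1 (R : realType) (x : R) : 0 < x -> ln x <= x - 1.
Proof.
move=> x0; have -> : ln x = ln (1 + (x - 1)) by congr ln; ring.
by apply: le_ln1Dx; lra.
Qed.

Lemma lt1_mul_expr (R : realType) (a q : R) i :
  0 <= a -> a < 1 -> 0 < q -> q < 1 -> a * q ^+ i < 1.
Proof.
move=> a0 a1 q0 q1; have : q ^+ i <= 1 by apply: exprn_ile1; exact: ltW.
have : 0 < q ^+ i by rewrite exprn_gt0.
by nra.
Qed.

Lemma ln_qpochhammer_prod (R : realType) (a q : R) n :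
  0 <= a -> a < 1 -> 0 < q -> q < 1 ->
  ln (\prod_(0 <= i < n) (1 - a * q ^+ i))
    = \sum_(0 <= i < n) ln (1 - a * q ^+ i) /\
  0 < \prod_(0 <= i < n) (1 - a * q ^+ i).
Proof.
move=> a0 a1 q0 q1; elim: n => [|n [IH1 IH2]].
  by rewrite !big_geq// ln1.
have p0 : 0 < 1 - a * q ^+ n by rewrite subr_gt0 lt1_mul_expr.
by rewrite !big_nat_recr//= lnM ?posrE// IH1 mulr_gt0.
Qed.

(** From ln t >= 1 - 1 / t, each summand is at least - v / (1 - v) with
    v = a q ^ i <= a, and these are dominated by a geometric series. *)
Lemma sum_ln_qpochhammer_ge (R : realType) (a q : R) n :
  0 <= a -> a < 1 -> 0 < q -> q < 1 ->
  - (a / ((1 - a) * (1 - q))) <= \sum_(0 <= i < n) ln (1 - a * q ^+ i).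
Proof.
move=> a0 a1 q0 q1.
have term i : - (a / (1 - a)) * q ^+ i <= ln (1 - a * q ^+ i).
  have v1 := lt1_mul_expr i a0 a1 q0 q1.
  have qi0 : 0 < q ^+ i by rewrite exprn_gt0.
  have qi1 : q ^+ i <= 1 by apply: exprn_ile1; exact: ltW.
  have := @ln_le_subr1 _ (1 - a * q ^+ i)^-1.
  rewrite invr_gt0 subr_gt0 => /(_ v1).
  rewrite lnV ?posrE ?subr_gt0// lerNl; apply: le_trans.
  rewrite opprB -subr_ge0.
  have -> : 1 - (1 - a * q ^+ i)^-1 - - (a / (1 - a)) * q ^+ i
      = a ^+ 2 * q ^+ i * (1 - q ^+ i) / ((1 - a) * (1 - a * q ^+ i)).
    by field; rewrite !gt_eqF// subr_gt0.
  by rewrite divr_ge0// !mulr_ge0// ?subr_ge0 ?sqr_ge0// ltW.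
apply: le_trans (ler_sum_nat (fun i _ => term i)).
rewrite -mulr_sumr mulNr lerN2 invfM mulrA ler_wpM2l//.
  by rewrite divr_ge0// subr_ge0 ltW.
have q1' : 0 < 1 - q by lra.
rewrite -[leRHS]mulr1 ler_pdivlMl// big_mkord -opprB mulNr -subrX1 opprB gerBl.
by rewrite exprn_ge0// ltW.
Qed.

(** The partial products decrease and stay above a positive constant, so the
    limit is positive and ln is continuous there. *)
Lemma cvg_ln_qpochhammer (R : realType) (a q : R) :
  0 <= a -> a < 1 -> 0 < q -> q < 1 ->
  0 < qpochhammer a q /\
  \sum_(0 <= i < n) ln (1 - a * q ^+ i) @[n --> \oo] --> ln (qpochhammer a q).
Proof.
move=> a0 a1 q0 q1.
pose P n := \prod_(0 <= i < n) (1 - a * q ^+ i).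
pose m := expR (- (a / ((1 - a) * (1 - q)))).
have mP n : m <= P n.
  have [lnP P0] := ln_qpochhammer_prod n a0 a1 q0 q1.
  by rewrite -[P n]lnK ?posrE// ler_expR lnP sum_ln_qpochhammer_ge.
have cvP : cvgn P.
  apply: nonincreasing_is_cvgn; last by exists m => _ [n _ <-].
  apply/nonincreasing_seqP => n; rewrite /P big_nat_recr//= ger_pMr.
    by rewrite gerBl mulr_ge0// exprn_ge0// ltW.
  exact: lt_le_trans (expR_gt0 _) (mP n).
have L0 : 0 < qpochhammer a q.
  apply: lt_le_trans (expR_gt0 (- (a / ((1 - a) * (1 - q))))) _.
  by apply: limr_ge => //; near=> n; exact: mP.
split=> //.
have -> : (fun n => \sum_(0 <= i < n) ln (1 - a * q ^+ i)) = @ln R \o P.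
  by apply/funext => n /=; have [->] := ln_qpochhammer_prod n a0 a1 q0 q1.
by apply: continuous_cvg cvP; exact: continuous_ln.
Unshelve. all: by end_near. Qed.

Definition ln_qgamma_partial (R : realType) (q : R) (n : nat) (y : R) : R :=
  \sum_(0 <= i < n) ln (1 - q * q ^+ i)
  - \sum_(0 <= i < n) ln (1 - q `^ y * q ^+ i) + (1 - y) * ln (1 - q).

Lemma ltr_powR_base_lt1 (R : realType) (q x y : R) : 0 < q -> q < 1 -> x < y ->
  q `^ y < q `^ x.
Proof.
move=> q0 q1 xy; rewrite /powR gt_eqF// ltr_expR ltr_nM2r//.
by rewrite ln_lt0// q0.
Qed.

Lemma powR_base_lt1 (R : realType) (q y : R) :
  0 < q -> q < 1 -> 0 < y -> q `^ y < 1.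
Proof.
by move=> q0 q1 y0; rewrite -[ltRHS](powRr0 q) ltr_powR_base_lt1.
Qed.

Lemma cvg_ln_qgamma (R : realType) (q y : R) : 0 < q -> q < 1 -> 0 < y ->
  0 < qgamma q y /\
  ln_qgamma_partial q n y @[n --> \oo] --> ln (qgamma q y).
Proof.
move=> q0 q1 y0.
have [N0 cvN] := cvg_ln_qpochhammer (ltW q0) q1 q0 q1.
have [D0 cvD] :=
  cvg_ln_qpochhammer (powR_ge0 q y) (powR_base_lt1 q0 q1 y0) q0 q1.
have q1' : 0 < 1 - q by lra.
split; first by rewrite /qgamma mulr_gt0 ?divr_gt0 ?powR_gt0.
rewrite /qgamma lnM ?posrE ?divr_gt0 ?powR_gt0// ln_div ?posrE// ln_powR//.
by apply: cvgD; [exact: cvgB|exact: cvg_cst].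
Qed.

(** * Derivatives of the truncated logarithm *)

Definition odds (R : realType) (u : R) : R := u / (1 - u).

(** The Koebe function of geometric function theory, u * odds'(u). *)
Definition koebe (R : realType) (u : R) : R := u / (1 - u) ^+ 2.

Lemma is_derive_powR_exponent (R : realType) (q y : R) : 0 < q ->
  is_derive y 1 (powR q) (ln q * q `^ y).
Proof.
move=> q0.
have -> : powR q = fun z => expR (z * ln q).
  by apply/funext => z; rewrite /powR gt_eqF.
have dlin : is_derive y 1 (fun z => z * ln q) (ln q).
  by apply: is_derive_eq; rewrite /GRing.scale/=; ring.
apply: (is_derive_eq (is_derive1_comp (is_derive_expR _) dlin)).
by rewrite mulrC.
Qed.

Lemma is_derive_ln_qfactor (R : realType) (q c y : R) :
  0 < q -> q `^ y * c < 1 ->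
  is_derive y 1 (fun z => ln (1 - q `^ z * c)) (- (ln q * odds (q `^ y * c))).
Proof.
move=> q0 u1.
have dp := is_derive_powR_exponent y q0.
have din : is_derive y 1 (fun z => 1 - q `^ z * c) (- (ln q * (q `^ y * c))).
  by apply: is_derive_eq; rewrite /GRing.scale/=; ring.
have u1' : 0 < 1 - q `^ y * c by rewrite subr_gt0.
apply: (is_derive_eq (@is_derive1_comp _ (@ln R)
  (fun z => 1 - q `^ z * c) _ _ _ (is_derive1_ln u1') din)).
by rewrite /odds; field; rewrite gt_eqF.
Qed.

Lemma is_derive_odds_powR (R : realType) (q c y : R) :
  0 < q -> q `^ y * c < 1 ->
  is_derive y 1 (fun z => odds (q `^ z * c)) (ln q * koebe (q `^ y * c)).
Proof.
move=> q0 u1.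
have dp := is_derive_powR_exponent y q0.
have u1' : 1 - q `^ y * c != 0 by rewrite gt_eqF// subr_gt0.
have din : is_derive y 1 (fun z => 1 - q `^ z * c) (- (ln q * (q `^ y * c))).
  by apply: is_derive_eq; rewrite /GRing.scale/=; ring.
have dinv := @is_deriveV _ (fun z => 1 - q `^ z * c) _ _ _ u1' din.
rewrite /odds; apply: is_derive_eq.
by rewrite /koebe /GRing.scale/=; field.
Qed.

Lemma is_derive_sum_nat (R : realType) (h dh : nat -> R -> R) (x : R) n :
  (forall i, is_derive x 1 (h i) (dh i x)) ->
  is_derive x 1 (fun z => \sum_(0 <= i < n) h i z) (\sum_(0 <= i < n) dh i x).
Proof.
move=> dhi; elim: n => [|n IH].
  rewrite big_geq//.
  have -> : (fun z => \sum_(0 <= i < 0) h i z) = cst (0 : R).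
    by apply/funext => z; rewrite big_geq.
  exact: is_derive_cst.
rewrite big_nat_recr//=.
have -> : (fun z => \sum_(0 <= i < n.+1) h i z)
    = (fun z => \sum_(0 <= i < n) h i z) \+ h n.
  by apply/funext => z; rewrite big_nat_recr.
exact: is_deriveD.
Qed.

Definition qdigamma_partial (R : realType) (q : R) (n : nat) (y : R) : R :=
  ln q * \sum_(0 <= i < n) odds (q `^ y * q ^+ i) - ln (1 - q).

Definition qtrigamma_partial (R : realType) (q : R) (n : nat) (y : R) : R :=
  ln q ^+ 2 * \sum_(0 <= i < n) koebe (q `^ y * q ^+ i).

Lemma is_derive_ln_qgamma_partial (R : realType) (q y : R) n :
  0 < q -> q < 1 -> 0 < y ->
  is_derive y 1 (ln_qgamma_partial q n) (qdigamma_partial q n y).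
Proof.
move=> q0 q1 y0.
have dS := @is_derive_sum_nat _ (fun i z => ln (1 - q `^ z * q ^+ i))
  (fun i z => - (ln q * odds (q `^ z * q ^+ i))) y n.
have {}dS := dS (fun i => is_derive_ln_qfactor q0
  (lt1_mul_expr i (powR_ge0 q y) (powR_base_lt1 q0 q1 y0) q0 q1)).
rewrite /ln_qgamma_partial; apply: is_derive_eq.
by rewrite /qdigamma_partial /GRing.scale/= sumrN -mulr_sumr; ring.
Qed.

Lemma is_derive_qdigamma_partial (R : realType) (q y : R) n :
  0 < q -> q < 1 -> 0 < y ->
  is_derive y 1 (qdigamma_partial q n) (qtrigamma_partial q n y).
Proof.
move=> q0 q1 y0.
have dS := @is_derive_sum_nat _ (fun i z => odds (q `^ z * q ^+ i))
  (fun i z => ln q * koebe (q `^ z * q ^+ i)) y n.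
have {}dS := dS (fun i => is_derive_odds_powR q0
  (lt1_mul_expr i (powR_ge0 q y) (powR_base_lt1 q0 q1 y0) q0 q1)).
rewrite /qdigamma_partial; apply: is_derive_eq.
by rewrite /qtrigamma_partial /GRing.scale/= -mulr_sumr; ring.
Qed.

Lemma is_derive_reflect (R : realType) (f : R -> R) (d x : R) :
  is_derive (1 - x) 1 f d -> is_derive x 1 (fun z => f (1 - z)) (- d).
Proof.
move=> df; have din : is_derive x 1 (fun z : R => 1 - z) (-1 : R).
  by apply: is_derive_eq; rewrite /GRing.scale/=; ring.
apply: (is_derive_eq (@is_derive1_comp _ f (fun z => 1 - z) _ _ _ df din)).
by rewrite mulrN1.
Qed.

Lemma koebe_lt (R : realType) (v u : R) : 0 < v -> v < u -> u < 1 ->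
  koebe v < koebe u.
Proof.
move=> v0 vu u1; rewrite /koebe ltr_pM//; [exact: ltW| |].
- by rewrite invr_ge0 sqr_ge0.
- rewrite ltf_pV2 ?posrE ?exprn_gt0 ?subr_gt0//; last exact: lt_trans u1.
  by rewrite ltrXn2r ?nnegrE//; lra.
Qed.

(** * The quotient of q-gamma values at 1 - x and x *)

(** The logarithm of the inverse quotient is the odd part of ln Gamma_q about
    1/2, up to a factor 2. Its second derivative is, up to the factor
    (ln q) ^ 2, the sum of koebe (q ^ (x + i)) - koebe (q ^ (1 - x + i)), and
    q ^ x > q ^ (1 - x) for x < 1/2. *)
Lemma strictly_log_concave_qgamma_reflection (R : realType) (q : R) :
  0 < q -> q < 1 ->
  strictly_log_concave_on `]0, (1 / 2)]
    (fun x : R => qgamma q (1 - x) / qgamma q x).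
Proof.
move=> q0 q1.
have gq y (y0 : 0 < y) := cvg_ln_qgamma q0 q1 y0.
split=> [x /=|].
  rewrite in_itv/= => /andP[x0 x2].
  have x1 : 0 < 1 - x by lra.
  by rewrite divr_gt0//; [case: (gq _ x1)|case: (gq _ x0)].
suff cvx : strictly_convex_on `]0, (1 / 2)]
    (fun x : R => - ln (qgamma q (1 - x) / qgamma q x)).
  by move=> x y t Dx Dy xy t0 t1; have := cvx x y t Dx Dy xy t0 t1; lra.
apply: strictly_convex_on_chord_gap => a b t /=.
rewrite !in_itv/= => /andP[a0 _] /andP[_ b2] ab t0 t1.
pose anti (f : R -> R) (x : R) := f x - f (1 - x).
pose sym (f : R -> R) (x : R) := f x + f (1 - x).
have danti (f f1 : R -> R) : (forall x : R, 0 < x -> is_derive x 1 f (f1 x)) ->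
    forall x, a <= x <= b -> is_derive x 1 (anti f) (sym f1 x).
  move=> df x /andP[ax xb].
  have dx : is_derive x 1 f (f1 x) by apply: df; lra.
  have /is_derive_reflect dx1 : is_derive (1 - x) 1 f (f1 (1 - x)).
    by apply: df; lra.
  by rewrite /anti; apply: is_derive_eq; rewrite /sym opprK.
have dsym (f f1 : R -> R) : (forall x : R, 0 < x -> is_derive x 1 f (f1 x)) ->
    forall x, a <= x <= b -> is_derive x 1 (sym f) (anti f1 x).
  move=> df x /andP[ax xb].
  have dx : is_derive x 1 f (f1 x) by apply: df; lra.
  have /is_derive_reflect dx1 : is_derive (1 - x) 1 f (f1 (1 - x)).
    by apply: df; lra.
  by rewrite /sym; apply: is_derive_eq.
have koebe_mono i x : a < x < b ->
    koebe (q `^ (1 - x) * q ^+ i) < koebe (q `^ x * q ^+ i).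
  move=> /andP[ax xb]; have x0 : 0 < x by lra.
  apply: koebe_lt; first by rewrite mulr_gt0 ?powR_gt0 ?exprn_gt0.
    by rewrite ltr_pM2r ?exprn_gt0// ltr_powR_base_lt1//; lra.
  by rewrite lt1_mul_expr ?powR_ge0 ?powR_base_lt1.
have l2 : 0 < ln q ^+ 2.
  by rewrite lt_neqAle sqr_ge0 eq_sym sqrf_eq0 lt_eqF// ln_lt0// q0.
(* The index is shifted so that the summand i = 0, which serves as the strictly
   convex comparison function F 0, is always present. *)
pose F n := anti (ln_qgamma_partial q n.+1).
pose F1 n := sym (qdigamma_partial q n.+1).
pose F2 n := anti (qtrigamma_partial q n.+1).
apply: (@chord_gap_lim_gt0 _ _ (F 0%N) (F1 0%N) (F2 0%N) F F1 F2
  (fun n => q ^+ n)) => //.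
- move=> x /andP[ax xb].
  have x0 : 0 < x by lra.
  have x1 : 0 < 1 - x by lra.
  have [gx cx] := gq _ x0.
  have [gx1 cx1] := gq _ x1.
  rewrite ln_div ?posrE// opprB.
  by apply: cvgB; rewrite (cvg_shiftS (fun n => ln_qgamma_partial q n _)).
- by apply: cvg_expr; rewrite gtr0_norm.
- move=> n; apply: danti => x x0; exact: is_derive_ln_qgamma_partial.
- move=> n; apply: dsym => x x0; exact: is_derive_qdigamma_partial.
- by apply: danti => x x0; exact: is_derive_ln_qgamma_partial.
- by apply: dsym => x x0; exact: is_derive_qdigamma_partial.
- move=> x xab; rewrite /F2 /anti /qtrigamma_partial.
  rewrite !big_nat1 subr_gt0 ltr_pM2l//.
  exact: koebe_mono.
- move=> n x xab; apply: (@lt_le_trans _ _ (F2 0%N x)).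
    by rewrite gtrBl exprn_gt0.
  rewrite /F2 /anti /qtrigamma_partial -!mulrBr ler_pM2l// -!sumrB.
  rewrite big_nat1 big_nat_recl//= lerDl.
  by apply: sumr_ge0 => i _; rewrite subr_ge0 ltW// koebe_mono.
Qed.

(** * Telescoping bounds *)

Lemma one_sub_le_Nln (R : realType) (q : R) : 0 < q -> 1 - q <= - ln q.
Proof. by move=> q0; have := ln_le_subr1 q0; lra. Qed.

Lemma Nln_mul_le_one_sub (R : realType) (q : R) : 0 < q -> - ln q * q <= 1 - q.
Proof.
move=> q0; rewrite -lnV ?posrE// -ler_pdivlMr//.
have := @ln_le_subr1 _ q^-1; rewrite invr_gt0 => /(_ q0) /le_trans; apply.
by rewrite mulrBl mulfV ?gt_eqF// mul1r.
Qed.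

(** Summed over u, u q, u q ^ 2, etc. this is the comparison of the trigamma
    series with an integral. Replacing - ln q by the smaller 1 - q leaves an
    exact rational surplus, at least the square kept on the left. *)
Lemma koebe_ge_odds_diff (R : realType) (q u : R) : 0 < q -> q < 1 ->
  0 < u -> u < 1 ->
  odds u - odds (u * q) + ((1 - q) * u) ^+ 2 <= - ln q * koebe u.
Proof.
move=> q0 q1 u0 u1.
have v1 : u * q < 1 by nra.
have v0 : 0 < u * q by rewrite mulr_gt0.
have k0 : 0 <= koebe u by rewrite divr_ge0 ?sqr_ge0// ltW.
apply: le_trans (ler_wpM2r k0 (one_sub_le_Nln q0)).
rewrite addrC -lerBrDr.
have -> : (1 - q) * koebe u - (odds u - odds (u * q))
    = ((1 - q) * u) ^+ 2 / ((1 - u) ^+ 2 * (1 - u * q)).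
  by rewrite /koebe /odds; field; rewrite !gt_eqF ?subr_gt0.
rewrite ler_pdivlMr; last by rewrite mulr_gt0 ?exprn_gt0 ?subr_gt0.
rewrite ler_piMr ?sqr_ge0// mulr_ile1 ?sqr_ge0 ?subr_ge0 ?(ltW v1)//.
  by rewrite exprn_ile1//; lra.
by lra.
Qed.

(** Up to the factor - ln q, odds (q ^ t) is the derivative of ln (1 - q ^ t),
    and it decreases in t: its value at y + 1 is at most its mean over
    [y, y + 1]. *)
Lemma odds_le_ln_diff (R : realType) (q u : R) : 0 < q -> q < 1 ->
  0 < u -> u < 1 -> - ln q * odds (u * q) <= ln (1 - u * q) - ln (1 - u).
Proof.
move=> q0 q1 u0 u1.
have v1 : 0 < 1 - u * q by nra.
have u1' : 0 < 1 - u by lra.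
have -> : ln (1 - u * q) - ln (1 - u) = - ln ((1 - u) / (1 - u * q)).
  by rewrite ln_div ?posrE// opprB.
have := @ln_le_subr1 _ ((1 - u) / (1 - u * q)); rewrite divr_gt0// => /(_ isT).
rewrite -lerN2; apply: le_trans.
have -> : - ((1 - u) / (1 - u * q) - 1) = (1 - q) * (u / (1 - u * q)).
  by field; rewrite gt_eqF.
have -> : - ln q * odds (u * q) = (- ln q * q) * (u / (1 - u * q)).
  by rewrite /odds; field; rewrite gt_eqF.
by rewrite ler_wpM2r ?Nln_mul_le_one_sub// divr_ge0// ltW.
Qed.

Lemma sum_koebe_ge (R : realType) (q u : R) n : 0 < q -> q < 1 ->
  0 < u -> u < 1 ->
  odds u - odds (u * q ^+ n.+1) + ((1 - q) * u) ^+ 2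
    <= - ln q * \sum_(0 <= i < n.+1) koebe (u * q ^+ i).
Proof.
move=> q0 q1 u0 u1; elim: n => [|n IH].
  by rewrite big_nat1 expr1 expr0 mulr1 koebe_ge_odds_diff.
have v0 : 0 < u * q ^+ n.+1 by rewrite mulr_gt0 ?exprn_gt0.
have := koebe_ge_odds_diff q0 q1 v0 (lt1_mul_expr n.+1 (ltW u0) u1 q0 q1).
have := sqr_ge0 ((1 - q) * (u * q ^+ n.+1)).
rewrite big_nat_recr//= mulrDr -mulrA -exprSr.
by move: IH; lra.
Qed.

Lemma sum_odds_le (R : realType) (q u : R) n : 0 < q -> q < 1 ->
  0 < u -> u < 1 ->
  - ln q * \sum_(0 <= i < n.+1) odds (u * q ^+ i)
    <= - ln q * odds u + ln (1 - u * q ^+ n) - ln (1 - u).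
Proof.
move=> q0 q1 u0 u1; elim: n => [|n IH].
  by rewrite big_nat1 expr0 mulr1; lra.
have v0 : 0 < u * q ^+ n by rewrite mulr_gt0 ?exprn_gt0.
have := odds_le_ln_diff q0 q1 v0 (lt1_mul_expr n (ltW u0) u1 q0 q1).
rewrite big_nat_recr//= mulrDr -mulrA -exprSr.
by move: IH; lra.
Qed.

(** The truncated form of (y + 1) psi' + 2 psi > 0. After the telescoping bounds
    there remains (y - 1) * L * odds u + 2 * ln ((1 - u) / (1 - q)), which is
    nonnegative because y >= 1, equivalently u <= q. The odds on the left is
    the end term of the telescoping and tends to 0 with n. *)
Lemma qtrigamma_qdigamma_partial_ge (R : realType) (q y : R) n :
  0 < q -> q < 1 -> 1 <= y ->
  (y + 1) * (- ln q * (((1 - q) * q `^ y) ^+ 2 - odds (q `^ y * q ^+ n.+1)))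
    <= (y + 1) * qtrigamma_partial q n.+1 y + 2 * qdigamma_partial q n.+1 y.
Proof.
move=> q0 q1 y1; have y0 : 0 < y by lra.
set u := q `^ y.
have u0 : 0 < u by rewrite powR_gt0.
have u1 : u < 1 by rewrite powR_base_lt1.
have uq : u <= q.
  rewrite /u -[leRHS]powRr1 ?(ltW q0)//.
  move: y1; rewrite le_eqVlt => /predU1P[<-//|y1].
  by rewrite ltW// ltr_powR_base_lt1.
have L0 : 0 < - ln q by rewrite oppr_gt0 ln_lt0// q0.
have T := ler_wpM2l (ltW L0) (sum_koebe_ge n q0 q1 u0 u1).
have S := sum_odds_le n q0 q1 u0 u1.
have lnu : ln (1 - q) <= ln (1 - u) by rewrite ler_ln ?posrE ?subr_gt0//; lra.
have lnun : ln (1 - u * q ^+ n) <= 0.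
  by rewrite ln_le0// gerBl mulr_ge0 ?exprn_ge0// ltW.
have o0 : 0 <= - ln q * odds u by rewrite mulr_ge0 ?divr_ge0 ?subr_ge0// ltW.
rewrite /qtrigamma_partial /qdigamma_partial -/u.
set SK := \sum_(_ <= _ < _) koebe _ in T *.
set SO := \sum_(_ <= _ < _) odds _ in S *.
set D := ((1 - q) * u) ^+ 2 in T *; set E := odds (u * _) in T *.
have {}T : - ln q * (odds u - E + D) <= ln q ^+ 2 * SK.
  by rewrite -sqrrN expr2 -mulrA.
have y10 : 0 <= y + 1 by lra.
have {}T := ler_wpM2l y10 T.
have yo : 0 <= (y - 1) * (- ln q * odds u) by rewrite mulr_ge0//; lra.
by lra.
Qed.

(** * The q-gamma function at (1 - x) / x *)

Lemma is_derive_inversion (R : realType) (x : R) : x != 0 ->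
  is_derive x 1 (fun z => (1 - z) / z) (- x ^- 2).
Proof.
move=> x0.
have dV := @is_deriveV _ id _ _ _ x0 (is_derive_id x 1).
apply: is_derive_eq; rewrite /GRing.scale/=; field; exact: x0.
Qed.

Lemma is_derive_comp_inversion (R : realType) (f : R -> R) (d x : R) : x != 0 ->
  is_derive ((1 - x) / x) 1 f d ->
  is_derive x 1 (fun z => f ((1 - z) / z)) (- x ^- 2 * d).
Proof.
move=> x0 df.
apply: (is_derive_eq (@is_derive1_comp _ f (fun z => (1 - z) / z) _ _ _ df
  (is_derive_inversion x0))).
exact: mulrC.
Qed.

(** The factor y + 1 with y = (1 - x) / x, which equals 1 / x, is kept in this
    form to match qtrigamma_qdigamma_partial_ge. *)
Lemma is_derive2_comp_inversion (R : realType) (f : R -> R) (d1 d2 x : R) :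
  x != 0 -> f ((1 - x) / x) = d1 -> is_derive ((1 - x) / x) 1 f d2 ->
  is_derive x 1 (fun z => - z ^- 2 * f ((1 - z) / z))
    (x ^- 3 * (((1 - x) / x + 1) * d2 + 2 * d1)).
Proof.
move=> x0 fx df.
have dcomp := is_derive_comp_inversion x0 df.
have x2 : x ^+ 2 != 0 by rewrite expf_neq0.
have dX : is_derive x 1 (fun z : R => z ^+ 2) (2 * x).
  by apply: is_derive_eq; rewrite /GRing.scale/=; ring.
have dV := @is_deriveV _ (fun z => z ^+ 2) _ _ _ x2 dX.
apply: is_derive_eq; rewrite /GRing.scale/= fx; field; exact: x0.
Qed.

(** On [a, b] with 0 < a and b <= 1/2 the factor x ^ -4 lies between 1 and
    a ^ -4, so the surplus of qtrigamma_qdigamma_partial_ge keeps the second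
    derivatives above a positive constant, and its end term is O(q ^ n). *)
Lemma strictly_log_convex_qgamma_inversion (R : realType) (q : R) :
  0 < q -> q < 1 ->
  strictly_log_convex_on `]0, (1 / 2)] (fun x : R => qgamma q ((1 - x) / x)).
Proof.
move=> q0 q1; have q1' : 0 < 1 - q by lra.
have L0 : 0 < - ln q by rewrite oppr_gt0 ln_lt0// q0.
have inv_ge1 x : 0 < x -> x <= 1 / 2 -> 1 <= (1 - x) / x :> R.
  by move=> x0 x2; rewrite ler_pdivlMr//; lra.
have inv_gt0 x (x0 : 0 < x) (x2 : x <= 1 / 2) :=
  lt_le_trans ltr01 (inv_ge1 x x0 x2).
split=> [x /=|].
  rewrite in_itv/= => /andP[x0 x2].
  by have [] := cvg_ln_qgamma q0 q1 (inv_gt0 x x0 x2).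
apply: strictly_convex_on_chord_gap => a b t /=.
rewrite !in_itv/= => /andP[a0 _] /andP[_ b2] ab t0 t1.
(* The surplus L (1 - q) ^ 2 u ^ 2 at x = a, where u = q ^ ((1 - x) / x) is
   smallest on [a, b]. *)
pose c := - ln q * ((1 - q) * q `^ ((1 - a) / a)) ^+ 2.
have c0 : 0 < c by rewrite mulr_gt0// exprn_gt0// mulr_gt0// powR_gt0.
pose F n (x : R) := ln_qgamma_partial q n.+1 ((1 - x) / x).
pose F1 n (x : R) := - x ^- 2 * qdigamma_partial q n.+1 ((1 - x) / x).
pose F2 n (x : R) := x ^- 3 * (((1 - x) / x + 1)
  * qtrigamma_partial q n.+1 ((1 - x) / x)
  + 2 * qdigamma_partial q n.+1 ((1 - x) / x)).
apply: (@chord_gap_lim_gt0 _ _ (fun x => c / 2 * x ^+ 2) (fun x => c * x)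
  (cst c) F F1 F2 (fun n => a ^- 4 * - ln q / (1 - q) * q ^+ n)) => //.
- move=> x /andP[ax xb].
  have x0 : 0 < x by lra.
  have x2 : x <= 1 / 2 by lra.
  have [_] := cvg_ln_qgamma q0 q1 (inv_gt0 x x0 x2).
  by rewrite -(cvg_shiftS (fun n => ln_qgamma_partial q n _)).
- rewrite -[X in _ --> X](mulr0 (a ^- 4 * - ln q / (1 - q))).
  by apply: cvgM; [exact: cvg_cst|apply: cvg_expr; rewrite gtr0_norm].
- move=> n x /andP[ax xb].
  apply: is_derive_comp_inversion; first by rewrite gt_eqF//; lra.
  by apply: is_derive_ln_qgamma_partial => //; apply: inv_gt0; lra.
- move=> n x /andP[ax xb].
  apply: is_derive2_comp_inversion => //; first by rewrite gt_eqF//; lra.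
  by apply: is_derive_qdigamma_partial => //; apply: inv_gt0; lra.
- by move=> x _; apply: is_derive_eq; rewrite /GRing.scale/= mulr1; field.
- by move=> x _; apply: is_derive_eq; rewrite /GRing.scale/= mulr1.
- move=> n x /andP[ax xb].
  have x0 : 0 < x by lra.
  have y1 : 1 <= (1 - x) / x by apply: inv_ge1; lra.
  have := qtrigamma_qdigamma_partial_ge n q0 q1 y1.
  have xV3 : 0 < x ^- 3 by rewrite invr_gt0 exprn_gt0.
  rewrite -(ler_pM2l xV3) -/(F2 n x); apply: lt_le_trans.
  set y := (1 - x) / x; set u := q `^ y.
  have -> : y + 1 = x^-1 by rewrite /y; field; rewrite gt_eqF.
  have -> (Z : R) : x ^- 3 * (x^-1 * Z) = x ^- 4 * Z.
    by field; rewrite gt_eqF.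
  have u0 : 0 < u by rewrite powR_gt0.
  have u1 : u < 1 by rewrite powR_base_lt1//; exact: lt_le_trans y1.
  have v1 := lt1_mul_expr n.+1 (ltW u0) u1 q0 q1.
  (* q ^ n rather than q ^ n.+1 makes the bound strict. *)
  have v_lt : odds (u * q ^+ n.+1) < q ^+ n / (1 - q).
    have qn0 : 0 < q ^+ n by rewrite exprn_gt0.
    have qn1 : q ^+ n <= 1 by rewrite exprn_ile1// ltW.
    have uq : u * q < q by rewrite gtr_pMl.
    have uqn : u * q * q ^+ n <= u * q by rewrite ler_piMr// mulr_ge0// ltW.
    have uq1 : u * q * (1 - q) < 1 - q by rewrite gtr_pMl//; lra.
    rewrite /odds ltr_pdivrMr ?subr_gt0// mulrAC ltr_pdivlMr// exprS mulrA.
    rewrite mulrAC mulrC ltr_pM2l//.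
    by lra.
  have xV1 : 1 <= x ^- 4.
    by rewrite invf_ge1 ?exprn_gt0// exprn_ile1//; lra.
  have xVa : x ^- 4 <= a ^- 4.
    by rewrite lef_pV2 ?posrE ?exprn_gt0// lerXn2r ?nnegrE//; lra.
  have main : c <= x ^- 4 * (- ln q * ((1 - q) * u) ^+ 2).
    have cu : c <= - ln q * ((1 - q) * u) ^+ 2.
      rewrite ler_pM2l// lerXn2r ?nnegrE ?mulr_ge0 ?powR_ge0 ?(ltW q1')//.
      rewrite ler_pM2l// ltW// ltr_powR_base_lt1//.
      rewrite ltr_pdivlMr// mulrAC ltr_pdivrMr//.
      by lra.
    by apply: le_trans cu _; rewrite ler_peMl// mulr_ge0 ?sqr_ge0// ltW.
  have err : x ^- 4 * (- ln q * odds (u * q ^+ n.+1))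
      < a ^- 4 * - ln q / (1 - q) * q ^+ n.
    rewrite -!mulrA [(1 - q)^-1 * _]mulrC.
    apply: le_lt_trans (ler_wpM2r _ xVa) _.
      by rewrite mulr_ge0 ?divr_ge0 ?subr_ge0 ?mulr_ge0 ?exprn_ge0// ltW.
    by rewrite ltr_pM2l ?invr_gt0 ?exprn_gt0// ltr_pM2l.
  by rewrite mulrBr mulrBr /cst; lra.
Qed.

Theorem theorem7 (R : realType) (q : R) (hq0 : 0 < q) (hq1 : q < 1) :
  strictly_log_convex_on `]0, (1 / 2)]
    (fun x : R => qgamma q ((1 - x) / x)) /\
  strictly_log_concave_on `]0, (1 / 2)]
    (fun x : R => qgamma q (1 - x) / qgamma q x).
Proof.
split; first exact: strictly_log_convex_qgamma_inversion.
exact: strictly_log_concave_qgamma_reflection.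
Qed.
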